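(* Let $N\ge 1$ and let $\mathbf{M}=\begin{pmatrix}A&B\\C&D\end{pmatrix}$ be a real $2N\times 2N$ free symplectic matrix, i.e. $A,B,C,D$ are real $N\times N$ matrices with $AB^{T}=BA^{T}$, $CD^{T}=DC^{T}$, $AD^{T}-BC^{T}=I_{N}$ and $\det(B)\neq 0$. Let $f,g:\mathbb{R}^N\to\mathbb{C}$ be signals, let $z(\mathbf{t})=(f\star^{\mathbf{M}}g)(\mathbf{t})$ be their free metaplectic convolution, and let $Z_{\mathbf{M}},F_{\mathbf{M}},G_{\mathbf{M}}$ denote the free metaplectic transformations (FMT) of $z,f,g$ respectively. Then for all $\mathbf{u},\mathbf{t}\in\mathbb{R}^N$: $$Z_{\mathbf{M}}(\mathbf{u})=F_{\mathbf{M}}(\mathbf{u})\cdot G_{\mathbf{M}}(\mathbf{u}),$$ and $$z(\mathbf{t})=\mathcal{L}_{\mathbf{M}^{-1}}\left[F_{\mathbf{M}}(\mathbf{u})\,G_{\mathbf{M}}(\mathbf{u})\right](\mathbf{t}).$$ Moreover, $$\mathcal{L}_{\mathbf{M}}\left[f(\mathbf{t})\cdot g(\mathbf{t})\right](\mathbf{u})=\left(F_{\mathbf{M}}\star^{\mathbf{M}}G_{\mathbf{M}}\right)(\mathbf{u}),$$ where on the right-hand side $\star^{\mathbf{M}}$ is the convolution of spectra defined in the context.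
   Context: Vectors in $\mathbb{R}^N$ are row vectors; $X^{-T}=(X^{-1})^T$. FMT: for a signal $f$, $$\mathcal{L}_{\mathbf{M}}[f](\mathbf{u})=F_{\mathbf{M}}(\mathbf{u})=\frac{1}{|\det(B)|^{1/2}}\int_{\mathbb{R}^N}f(\mathbf{t})\,e^{\pi i(\mathbf{u}DB^{-1}\mathbf{u}^T+\mathbf{t}B^{-1}A\mathbf{t}^T)-2\pi i\,\mathbf{t}B^{-1}\mathbf{u}^T}\,d\mathbf{t}.$$ Inverse FMT: $$\mathcal{L}_{\mathbf{M}^{-1}}[H](\mathbf{t})=\frac{1}{|\det(B)|^{1/2}}\int_{\mathbb{R}^N}H(\mathbf{u})\,e^{-\pi i(\mathbf{u}B^{-T}D^T\mathbf{u}^T+\mathbf{t}A^TB^{-T}\mathbf{t}^T)+2\pi i\,\mathbf{u}B^{-T}\mathbf{t}^T}\,d\mathbf{u}.$$ Signals: the signals $f$ and $g$ are functions $\mathbb{R}^N\to\mathbb{C}$ such that the function and its FMT are both Lebesgue integrable (so that the integrals defining the FMTs $\mathcal{L}_{\mathbf{M}}[f]$, $\mathcal{L}_{\mathbf{M}}[g]$ and the inverse FMTs $\mathcal{L}_{\mathbf{M}^{-1}}[F_{\mathbf{M}}]$, $\mathcal{L}_{\mathbf{M}^{-1}}[G_{\mathbf{M}}]$ converge absolutely) and the inversion formula $f(\mathbf{t})=\mathcal{L}_{\mathbf{M}^{-1}}[F_{\mathbf{M}}](\mathbf{t})$ holds for all $\mathbf{t}$. Generalized translation of a signal $g$ by $\boldsymbol{\tau}$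 (the symbol $\theta$ is the generalized delay operator): $$g(\mathbf{t}\theta\boldsymbol{\tau})=\frac{1}{|\det(B)|}\int_{\mathbb{R}^N}G_{\mathbf{M}}(\mathbf{u})\,e^{\pi i(\boldsymbol{\tau}B^{-1}A\boldsymbol{\tau}^T-\mathbf{t}B^{-1}A\mathbf{t}^T)+2\pi i(\mathbf{t}-\boldsymbol{\tau})B^{-1}\mathbf{u}^T}\,d\mathbf{u}.$$ Generalized translation of a spectrum $G_{\mathbf{M}}$ by $\boldsymbol{\tau}$: $$G_{\mathbf{M}}(\mathbf{u}\theta\boldsymbol{\tau})=\frac{1}{|\det(B)|}\int_{\mathbb{R}^N}g(\mathbf{t})\,e^{\pi i(\mathbf{u}B^{-T}D^T\mathbf{u}^T-\boldsymbol{\tau}B^{-T}D^T\boldsymbol{\tau}^T)+2\pi i(\boldsymbol{\tau}-\mathbf{u})B^{-T}\mathbf{t}^T}\,d\mathbf{t}.$$ Set $$E(\mathbf{t},\mathbf{u})=e^{\pi i[\mathbf{u}(DB^{-1}-B^{-T}D^T)\mathbf{u}^T]}\,e^{\pi i[\mathbf{t}(B^{-1}A-A^TB^{-T})\mathbf{t}^T]-2\pi i(\mathbf{t}B^{-1}\mathbf{u}^T-\mathbf{u}B^{-T}\mathbf{t}^T)}$$ (for symplectic $\mathbf{M}$ this is identically $1$, so the definitions below do not depend on the extra variable). Free metaplectic convolution of signals, for any choice of $\mathbf{u}\in\mathbb{R}^N$: $$(f\star^{\mathbf{M}}g)(\mathbf{t})=\int_{\mathbb{R}^N}f(\boldsymbol{\tau})\,g(\mathbf{t}\theta\boldsymbol{\tau})\,E(\mathbf{t},\mathbf{u})\,d\boldsymbol{\tau}.$$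 Free metaplectic convolution of spectra, for any choice of $\mathbf{t}\in\mathbb{R}^N$: $$(F_{\mathbf{M}}\star^{\mathbf{M}}G_{\mathbf{M}})(\mathbf{u})=\int_{\mathbb{R}^N}F_{\mathbf{M}}(\boldsymbol{\tau})\,G_{\mathbf{M}}(\mathbf{u}\theta\boldsymbol{\tau})\,E(\mathbf{t},\mathbf{u})\,d\boldsymbol{\tau}.$$
   Formalization: The identity Z_M(u) = F_M(u)·G_M(u) is stated under the extra assumption that z is Lebesgue integrable; for some signals f, g the function z is not integrable and the integral defining Z_M does not exist. The other two identities are unconditional. *)

(* Defs.v *)
From HB Require Import structures.
From mathcomp Require Import all_boot all_order all_algebra.
From mathcomp Require Import all_classical all_reals all_analysis.
From mathcomp.real_closed Require Import complex.

Set Implicit Arguments.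
Unset Strict Implicit.
Unset Printing Implicit Defensive.
Import Order.TTheory GRing.Theory Num.Theory.
Import numFieldNormedType.Exports.

Local Open Scope classical_set_scope.
Local Open Scope ring_scope.
Local Open Scope complex_scope.

Section lebesgueN.
Context {R : realType}.

Definition tcons n (p : measurableTypeR R * n.-tuple (measurableTypeR R)) :
  n.+1.-tuple (measurableTypeR R) := [tuple of p.1 :: p.2].

(* The n-fold product of the Lebesgue measure, on the Borel sets of R^n. *)
Fixpoint lebesgueN (n : nat) : set (n.-tuple (measurableTypeR R)) -> \bar R :=
  match n with
  | 0 => dirac [tuple]
  | n'.+1 => pushforward (lebesgue_measure \x @lebesgueN n')%E (@tcons n')
  end.
Arguments lebesgueN : clear implicits.

Lemma measurable_tcons n : measurable_fun setT (@tcons n).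
Proof. exact: measurable_cons. Qed.

Lemma measurable_tdecons n :
  measurable_fun setT (fun t : n.+1.-tuple (measurableTypeR R) =>
    (thead t, [tuple of behead t])).
Proof.
apply/measurable_fun_pairP; split; first exact: measurable_tnth.
exact: measurable_behead.
Qed.

Lemma tcons_decons n (t : n.+1.-tuple (measurableTypeR R)) :
  tcons (thead t, [tuple of behead t]) = t.
Proof. by rewrite [RHS]tuple_eta. Qed.

Lemma tdecons_cons n (p : measurableTypeR R * n.-tuple (measurableTypeR R)) :
  (thead (tcons p), [tuple of behead (tcons p)]) = p.
Proof. by case: p => x t; congr pair => //; apply/val_inj. Qed.

Lemma lebesgueN_sfinite n :
  exists m : {sigma_finite_measure set (n.-tuple (measurableTypeR R)) -> \bar R},
    lebesgueN n = m.
Proof.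
elim: n => [|n [m mE]]; first by exists (dirac [tuple]).
pose h t : _ * n.-tuple (measurableTypeR R) := (thead t, [tuple of behead t]).
have hK p : h (tcons p) = p by exact: tdecons_cons.
pose nu0 mf : {measure set (n.+1.-tuple (measurableTypeR R)) -> \bar R} :=
  @measure_function_pushforward__canonical__measure_function_Measure
    _ _ _ _ R (lebesgue_measure \x m)%E (@tcons n) mf.
pose nu := nu0 (@measurable_tcons n).
have sf : sigma_finite setT nu.
  have /sigma_finiteP[F [TF ndF Foo]] := sigma_finiteT (@lebesgue_measure R).
  have /sigma_finiteP[G [TG ndG Goo]] := sigma_finiteT m.
  exists (fun k => h @^-1` (F k `*` G k)).
    rewrite -preimage_bigcup (_ : \bigcup_k _ = setT) ?preimage_setT//.
    rewrite -setXTT TF TG predeqE => -[x y]; split.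
      by move=> [k _ []/= ? ?]; split; exists k.
    move=> [/= [i _ Fix] [j _ Gjy]]; exists (maxn i j) => //; split.
      by move: x Fix; exact/subsetPset/ndF/leq_maxl.
    by move: y Gjy; exact/subsetPset/ndG/leq_maxr.
  move=> k; have [mF Fk] := Foo k; have [mG Gk] := Goo k; split.
    rewrite -[X in measurable X]setTI; apply: measurable_tdecons => //.
    exact: measurableX.
  rewrite /nu /= /pushforward (_ : _ @^-1` _ = F k `*` G k); last first.
    by apply/funext => p; rewrite -[in RHS](hK p).
  by rewrite product_measure1E// lte_mul_pinfty// ge0_fin_numE.
pose f : set (n.+1.-tuple (measurableTypeR R)) -> \bar R := nu.
pose H1 := isMeasure.Build _ _ _ f (measure0 nu) (measure_ge0 nu)
  (@measure_semi_sigma_additive _ _ _ nu).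
pose M1 : {measure set _ -> \bar R} := HB.pack f H1.
pose H2 := Measure_isSigmaFinite.Build _ _ _ M1 sf.
pose nu' : {sigma_finite_measure set _ -> \bar R} := HB.pack f H1 H2.
by exists nu'; rewrite /= mE.
Qed.

Let lebesgueN0 n : lebesgueN n set0 = 0%E.
Proof. by have [m ->] := lebesgueN_sfinite n; exact: measure0. Qed.

Let lebesgueN_ge0 n A : (0 <= lebesgueN n A)%E.
Proof. by have [m ->] := lebesgueN_sfinite n; exact: measure_ge0. Qed.

Let lebesgueN_sigma_additive n : semi_sigma_additive (lebesgueN n).
Proof.
by have [m ->] := lebesgueN_sfinite n; exact: measure_semi_sigma_additive.
Qed.

HB.instance Definition _ n := isMeasure.Build _ _ _ (lebesgueN n)
  (lebesgueN0 n) (@lebesgueN_ge0 n) (@lebesgueN_sigma_additive n).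

Let sigma_finite_lebesgueN n : sigma_finite setT (lebesgueN n).
Proof. by have [m ->] := lebesgueN_sfinite n; exact: sigma_finiteT. Qed.

HB.instance Definition _ n := Measure_isSigmaFinite.Build _ _ _ (lebesgueN n)
  (sigma_finite_lebesgueN n).

Lemma lebesgueN_box n (A : 'I_n -> set (measurableTypeR R)) :
  (forall i, measurable (A i)) ->
  lebesgueN n [set t | forall i, A i (tnth t i)] =
    (\prod_(i < n) lebesgue_measure (A i))%E.
Proof.
elim: n A => [|n IH] A mA.
  by rewrite big_ord0 /= /dirac indicE mem_set//= => -[].
rewrite big_ord_recl -IH//=.
rewrite /pushforward -product_measure1E//=; last first.
  rewrite (_ : mkset _ = \bigcap_(i : 'I_n) ((fun t => tnth t i) @^-1` A (lift ord0 i))).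
    apply: fin_bigcap_measurable => //= i _.
    by rewrite -[X in measurable X]setTI; exact: measurable_tnth.
  by apply/seteqP; split => [t At i _|t At i]; exact: At.
congr product_measure1; apply/seteqP; split => -[x t] /=.
  by move=> At; split => [|i]; [have := At ord0|have := At (lift ord0 i); rewrite tnthS].
move=> [A0 At] i; have [->//|i0] := eqVneq i ord0.
by case: (unliftP ord0 i) i0 => [j ->|-> /eqP//] _; rewrite tnthS.
Qed.

End lebesgueN.
Arguments lebesgueN {R} n _.

Section complex_integral.
Context {R : realType} {n : nat}.
Implicit Types h : 'rV[R]_n -> R[i].

(* The library carries the product sigma-algebra on tuples, not on row vectors;
   a row vector is identified with the tuple of its coordinates. *)
Definition row_of_tuple (t : n.-tuple (measurableTypeR R)) : 'rV[R]_n :=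
  \row_i tnth t i.

Definition cintegrable h : Prop :=
  (lebesgueN n).-integrable setT (fun t => (complex.Re (h (row_of_tuple t)))%:E) /\
  (lebesgueN n).-integrable setT (fun t => (complex.Im (h (row_of_tuple t)))%:E).

(* Total: only meaningful when [cintegrable h]. *)
Definition cintegral h : R[i] :=
  (\int[lebesgueN n]_t complex.Re (h (row_of_tuple t)))%R +i*
  (\int[lebesgueN n]_t complex.Im (h (row_of_tuple t)))%R.

End complex_integral.

(* e^{i x}, x real *)
Definition expi {R : realType} (x : R) : R[i] := cos x +i* sin x.

Section FMT.
Context {R : realType} {N : nat}.
Implicit Types (M : 'M[R]_(N + N)) (X : 'M[R]_N) (u t tau : 'rV[R]_N)
  (f g H : 'rV[R]_N -> R[i]).

Definition bform X u t : R := (u *m X *m t^T) 0 0.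

(* M = (A B; C D) *)
Definition mxA M : 'M[R]_N := ulsubmx M.
Definition mxB M : 'M[R]_N := ursubmx M.
Definition mxC M : 'M[R]_N := dlsubmx M.
Definition mxD M : 'M[R]_N := drsubmx M.

Definition free_symplectic M : Prop :=
  [/\ mxA M *m (mxB M)^T = mxB M *m (mxA M)^T,
      mxC M *m (mxD M)^T = mxD M *m (mxC M)^T,
      mxA M *m (mxD M)^T - mxB M *m (mxC M)^T = 1%:M
    & \det (mxB M) != 0].

Definition iB M : 'M[R]_N := invmx (mxB M).
(* B^{-T} *)
Definition iBT M : 'M[R]_N := (invmx (mxB M))^T.

Definition fmt M f u : R[i] :=
  ((Num.sqrt `|\det (mxB M)|)^-1)%:C *
  cintegral (fun t => f t *
    expi (pi * (bform (mxD M *m iB M) u u + bform (iB M *m mxA M) t t)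
          - 2 * pi * bform (iB M) t u)).

Definition ifmt M H t : R[i] :=
  ((Num.sqrt `|\det (mxB M)|)^-1)%:C *
  cintegral (fun u => H u *
    expi (- (pi * (bform (iBT M *m (mxD M)^T) u u
                   + bform ((mxA M)^T *m iBT M) t t))
          + 2 * pi * bform (iBT M) u t)).

(* Inversion holding everywhere, with [fmt M f] integrable, forces f to be
   continuous, so Borel (vs Lebesgue) measurability of f is no restriction. *)
Definition is_signal M f : Prop :=
  [/\ cintegrable f, cintegrable (fmt M f)
    & forall t, f t = ifmt M (fmt M f) t].

(* g(t theta tau) *)
Definition gtrans M g t tau : R[i] :=
  (`|\det (mxB M)|^-1)%:C *
  cintegral (fun u => fmt M g u *
    expi (pi * (bform (iB M *m mxA M) tau tau - bform (iB M *m mxA M) t t)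
          + 2 * pi * bform (iB M) (t - tau) u)).

(* G_M(u theta tau), which is defined in terms of the signal g *)
Definition gtrans_spec M g u tau : R[i] :=
  (`|\det (mxB M)|^-1)%:C *
  cintegral (fun t => g t *
    expi (pi * (bform (iBT M *m (mxD M)^T) u u
                - bform (iBT M *m (mxD M)^T) tau tau)
          + 2 * pi * bform (iBT M) (tau - u) t)).

(* Identically 1 when M is free symplectic. *)
Definition Efac M t u : R[i] :=
  expi (pi * bform (mxD M *m iB M - iBT M *m (mxD M)^T) u u) *
  expi (pi * bform (iB M *m mxA M - (mxA M)^T *m iBT M) t t
        - 2 * pi * (bform (iB M) t u - bform (iBT M) u t)).

(* (f * g)(t), with auxiliary parameter u *)
Definition fmconv M f g u t : R[i] :=
  cintegral (fun tau => f tau * gtrans M g t tau * Efac M t u).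

(* (F_M * G_M)(u) for F_M = fmt M f and G_M = fmt M g, with auxiliary
   parameter t *)
Definition fmconv_spec M f g t u : R[i] :=
  cintegral (fun tau => fmt M f tau * gtrans_spec M g u tau * Efac M t u).

End FMT.

(* Main.v *)
Require Import Defs.
From mathcomp Require Import all_boot all_order all_algebra.
From mathcomp Require Import all_classical all_reals all_analysis.
From mathcomp.real_closed Require Import complex.
From mathcomp Require Import measurable_realfun.
From mathcomp Require Import ring lra.

(** Write X = - 2 pi B^{-1} and let [fourier X] be the Fourier transform with kernel
    exp (i t X u^T). Up to the constant c = |det B|^{-1/2}, the FMT multiplies a signal
    by a chirp in t, applies [fourier X], and multiplies the result by a chirp in u; the
    inverse FMT undoes the chirps around [fourier (- X^T)]. A quadratic form does not
    distinguish a matrix from its transpose, so the chirps cancel exactly and the factor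
    [Efac] is 1.

    With the chirps removed, the formula for z (lemma [fmconv_ifmt]) and the formula for
    the FMT of f g (lemma [fmt_product]) are the same computation: insert the integral
    that defines the translate, respectively the inversion formula of f, and exchange
    the two integrals. Fubini applies because both functions are integrable and the
    oscillating kernel is bounded ([cintegral_fubini_fourier]).

    The identity Z = F G (lemma [fmt_fmconv]) then says that a Fourier transform can be
    inverted: z is, up to chirps, the inverse transform of the integrable function
    K = F G times a chirp, and K must be recovered from z. The usual proof regularizes
    with Gaussians. Here the signal f provides the test function: the chirped signal p
    is integrable, its transform P is integrable, and inversion holds for p by
    hypothesis. If p s <> 0 for some s, integrate z(t) p(s + e t) exp (i t X v^T). As
    e -> 0 this tends to p s times the transform of z at v, by dominated convergence.
    By Fubini and two affine changes of variables it also equals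
    the integral of K(v - e y) P(y) exp (- i s X y^T), which tends to K(v) times the
    inverse transform of P at s, that is K(v) p(s) / c^2 ([fourier_regularization],
    [fourier_inversion]). If p vanishes identically, so do F and z. The changes of
    variables rest on the behaviour of the Lebesgue measure on R^n under t |-> a + c t
    ([ge0_integral_affine]). *)

Set Implicit Arguments.
Unset Strict Implicit.
Unset Printing Implicit Defensive.
Import Order.TTheory GRing.Theory Num.Theory.
Import numFieldNormedType.Exports.

Local Open Scope classical_set_scope.
Local Open Scope ring_scope.
Local Open Scope complex_scope.

Local Notation Re := complex.Re.
Local Notation Im := complex.Im.

(** * Complex numbers and complex-valued integrals *)

Section complex_facts.
Context {R : realType}.
Implicit Types (x y : R[i]) (u v : nat -> R[i]).

Lemma cReM x y : Re (x * y) = Re x * Re y - Im x * Im y.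
Proof. by case: x; case: y. Qed.

Lemma cImM x y : Im (x * y) = Re x * Im y + Im x * Re y.
Proof. by case: x; case: y. Qed.

(** The l^1 norm on the complex numbers seen as R^2. It is submultiplicative and
    takes values in R, which suffices for every domination argument below. *)
Definition norm1 x : R := `|Re x| + `|Im x|.

Lemma norm1_ge0 x : 0 <= norm1 x.
Proof. exact: addr_ge0. Qed.

Lemma le_Re_norm1 x : `|Re x| <= norm1 x.
Proof. by rewrite lerDl. Qed.

Lemma le_Im_norm1 x : `|Im x| <= norm1 x.
Proof. by rewrite lerDr. Qed.

Lemma norm1M x y : norm1 (x * y) <= norm1 x * norm1 y.
Proof.
rewrite /norm1 cReM cImM.
apply: (le_trans (lerD (ler_normB _ _) (ler_normD _ _))).
rewrite !normrM; set a := `|Re x|; set b := `|Im x|; set c := `|Re y|.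
set d := `|Im y|; lra.
Qed.

Lemma norm1_expi (a : R) : norm1 (expi a) <= 2.
Proof.
by rewrite /norm1 /=; apply: (lerD (y := 1) (t := 1));
  rewrite ler_norml ?cos_geN1 ?cos_le1 ?sin_geN1 ?sin_le1.
Qed.

Lemma expi0 : expi (0 : R) = 1.
Proof. by rewrite /expi cos0 sin0. Qed.

Lemma expiD (a b : R) : expi (a + b) = expi a * expi b.
Proof.
apply/eqP; rewrite eq_complex cReM cImM /= cosD sinD eqxx /=.
by apply/eqP; ring.
Qed.

(** Convergence of a sequence of complex numbers, taken coordinatewise. *)
Definition ccvg u x :=
  (fun k => Re (u k)) @ \oo --> Re x /\ (fun k => Im (u k)) @ \oo --> Im x.

Lemma ccvg_cst x : ccvg (fun=> x) x.
Proof. by split; exact: cvg_cst. Qed.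

Lemma ccvgM u v x y : ccvg u x -> ccvg v y -> ccvg (fun k => u k * v k) (x * y).
Proof.
move=> [u1 u2] [v1 v2]; split.
  rewrite (_ : (fun _ => _) = fun k => Re (u k) * Re (v k) - Im (u k) * Im (v k)).
    by rewrite cReM; apply: cvgB; exact: cvgM.
  by apply/funext => k; rewrite cReM.
rewrite (_ : (fun _ => _) = fun k => Re (u k) * Im (v k) + Im (u k) * Re (v k)).
  by rewrite cImM; apply: cvgD; exact: cvgM.
by apply/funext => k; rewrite cImM.
Qed.

Lemma ccvg_unique u x y : ccvg u x -> ccvg u y -> x = y.
Proof.
move=> [u1 u2] [v1 v2]; apply/eqP; rewrite eq_complex.
by apply/andP; split; apply/eqP; [exact: cvg_unique u1 v1|exact: cvg_unique u2 v2].
Qed.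

Lemma ccvg_expi (a : nat -> R) (b : R) :
  a @ \oo --> b -> ccvg (fun k => expi (a k)) (expi b).
Proof.
move=> ab; split => /=.
  by apply: continuous_cvg => //; exact: continuous_cos.
by apply: continuous_cvg => //; exact: continuous_sin.
Qed.

End complex_facts.

Section complex_measurable.
Context d (T : measurableType d) {R : realType}.
Implicit Types h k : T -> R[i].

(** Borel measurability of a complex-valued function, taken coordinatewise. *)
Definition cmeasurable h :=
  measurable_fun setT (fun t => Re (h t)) /\
  measurable_fun setT (fun t => Im (h t)).

Lemma cmeasurable_cst x : cmeasurable (fun=> x).
Proof. by split; exact: measurable_cst. Qed.

Lemma cmeasurableM h k :
  cmeasurable h -> cmeasurable k -> cmeasurable (fun t => h t * k t).
Proof.
move=> [h1 h2] [k1 k2]; split.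
  under eq_fun do rewrite cReM.
  by apply: measurable_funB; exact: measurable_funM.
under eq_fun do rewrite cImM.
by apply: measurable_funD; exact: measurable_funM.
Qed.

Lemma cmeasurable_expi (a : T -> R) :
  measurable_fun setT a -> cmeasurable (fun t => expi (a t)).
Proof.
move=> ma; split => /=.
  apply: (measurableT_comp (f := cos) _ ma).
  by apply: continuous_measurable_fun; exact: continuous_cos.
apply: (measurableT_comp (f := sin) _ ma).
by apply: continuous_measurable_fun; exact: continuous_sin.
Qed.

End complex_measurable.

Lemma cmeasurable_comp d1 d2 (T1 : measurableType d1) (T2 : measurableType d2)
    (R : realType) (h : T2 -> R[i]) (a : T1 -> T2) :
  cmeasurable h -> measurable_fun setT a -> cmeasurable (fun t => h (a t)).
Proof.
move=> [h1 h2] ma; split; first exact: (measurableT_comp h1).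
exact: (measurableT_comp h2).
Qed.

Section complex_integral.
Context d (T : measurableType d) {R : realType}.
Variable mu : {measure set T -> \bar R}.
Implicit Types h k : T -> R[i].

(** The integral of a complex-valued function. With [mu] the measure [lebesgueN n]
    and [h] precomposed with [row_of_tuple] it unfolds to [cintegral]. *)
Definition cint h : R[i] :=
  (\int[mu]_t Re (h t))%R +i* (\int[mu]_t Im (h t))%R.

(** Integrability of the real and imaginary parts; unfolds to [cintegrable] in the
    same way. *)
Definition cintble h : Prop :=
  mu.-integrable setT (fun t => (Re (h t))%:E) /\
  mu.-integrable setT (fun t => (Im (h t))%:E).

Lemma cintble_measurable h : cintble h -> cmeasurable h.
Proof.
by move=> [/measurable_int/measurable_EFinP h1 /measurable_int/measurable_EFinP h2].
Qed.

Lemma cintble_norm1 h : cintble h ->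
  mu.-integrable setT (fun t => (norm1 (h t))%:E).
Proof.
move=> [h1 h2]; rewrite /norm1; under eq_fun do rewrite EFinD.
by apply: integrableD => //; exact: integrable_norm.
Qed.

Lemma cintble_dominated h (g : T -> R) : cmeasurable h ->
  mu.-integrable setT (fun t => (g t)%:E) ->
  (forall t, norm1 (h t) <= g t) -> cintble h.
Proof.
move=> [h1 h2] ig hg.
have g0 t : 0 <= g t by rewrite (le_trans _ (hg t)) ?norm1_ge0.
split; apply: le_integrable ig => //; try exact/measurable_EFinP.
  by move=> t _; rewrite lee_fin (ger0_norm (g0 t)) (le_trans _ (hg t)) ?le_Re_norm1.
by move=> t _; rewrite lee_fin (ger0_norm (g0 t)) (le_trans _ (hg t)) ?le_Im_norm1.
Qed.

Lemma cintbleM h k (C : R) : cintble h -> cmeasurable k ->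
  (forall t, norm1 (k t) <= C) -> cintble (fun t => h t * k t).
Proof.
move=> ih mk kC; apply: (@cintble_dominated _ (fun t => C * norm1 (h t))).
- by apply: cmeasurableM => //; exact: cintble_measurable.
- under eq_fun do rewrite EFinM.
  by apply: integrableZl => //; exact: cintble_norm1.
- move=> t; apply: (le_trans (norm1M _ _)); rewrite mulrC.
  by apply: ler_wpM2r => //; exact: norm1_ge0.
Qed.

Lemma cintbleZ c h : cintble h -> cintble (fun t => c * h t).
Proof.
move=> ih; under eq_fun do rewrite mulrC.
by apply: (@cintbleM _ _ (norm1 c)) => //; exact: cmeasurable_cst.
Qed.

Lemma cintZ c h : cintble h -> cint (fun t => c * h t) = c * cint h.
Proof.
move=> [h1 h2]; have iZ (a : R) (p : T -> R) : mu.-integrable setT (EFin \o p) ->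
    mu.-integrable setT (EFin \o (fun t => a * p t)).
  by move=> ip; rewrite /comp; under eq_fun do rewrite EFinM; exact: integrableZl.
apply/eqP; rewrite eq_complex cReM cImM /=; apply/andP; split; apply/eqP.
  under eq_Rintegral do rewrite cReM.
  by rewrite RintegralB ?RintegralZl//; exact: iZ.
under eq_Rintegral do rewrite cImM.
by rewrite RintegralD ?RintegralZl//; exact: iZ.
Qed.

Lemma norm1_cint h : cintble h ->
  norm1 (cint h) <= \int[mu]_t norm1 (h t).
Proof.
move=> [h1 h2]; rewrite /norm1 RintegralD//; try exact: integrable_norm.
by apply: lerD; exact: le_normr_Rintegral.
Qed.

(** Dominated convergence for complex-valued functions. *)
Lemma cint_dominated_cvg (H : nat -> T -> R[i]) h (g : T -> R) :
  (forall i, cmeasurable (H i)) -> cmeasurable h ->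
  (forall t, ccvg (H ^~ t) (h t)) ->
  mu.-integrable setT (fun t => (g t)%:E) ->
  (forall i t, norm1 (H i t) <= g t) ->
  ccvg (fun i => cint (H i)) (cint h).
Proof.
move=> mH mh Hh ig Hg.
(* [p] stands for the real or the imaginary part. *)
have main (p : R[i] -> R) : (forall i, measurable_fun setT (fun t => p (H i t))) ->
    measurable_fun setT (fun t => p (h t)) ->
    (forall t, (fun i => p (H i t)) @ \oo --> p (h t)) ->
    (forall x, `|p x| <= norm1 x) ->
    (fun i => \int[mu]_t p (H i t))%R @ \oo --> (\int[mu]_t p (h t))%R.
  move=> mpH mph cv pn.
  have mHE i : measurable_fun setT (fun t => (p (H i t))%:E).
    exact/measurable_EFinP.
  have mhE : measurable_fun setT (fun t => (p (h t))%:E) by exact/measurable_EFinP.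
  have cvE : {ae mu, forall t, setT t ->
      (fun i => (p (H i t))%:E) @ \oo --> (p (h t))%:E}.
    by apply: aeW => t _; apply: cvg_EFin; [exact: nearW|exact: cv].
  have HgE : {ae mu, forall t i, setT t -> (`|(p (H i t))%:E| <= (g t)%:E)%E}.
    by apply: aeW => t i _; rewrite lee_fin (le_trans (pn _)).
  have [ih _ lim] := dominated_convergence measurableT mHE mhE cvE ig HgE.
  by apply: fine_cvg; rewrite fineK //; exact: integrable_fin_num.
split; (apply: main; [move=> i|idtac|move=> t|]).
- by case: (mH i).
- by case: mh.
- by case: (Hh t).
- exact: le_Re_norm1.
- by case: (mH i).
- by case: mh.
- by case: (Hh t).
- exact: le_Im_norm1.
Qed.

End complex_integral.

(** * Fubini for complex-valued functions *)

Section complex_fubini.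
Context d1 d2 (T1 : measurableType d1) (T2 : measurableType d2) {R : realType}.
Variables (m1 : {sigma_finite_measure set T1 -> \bar R})
          (m2 : {sigma_finite_measure set T2 -> \bar R}).

Lemma integrable_prod_dominated (p : T1 * T2 -> R) (a : T1 -> R) (b : T2 -> R) :
  measurable_fun setT p ->
  m1.-integrable setT (fun x => (a x)%:E) ->
  m2.-integrable setT (fun y => (b y)%:E) ->
  (forall x y, `|p (x, y)| <= a x * b y) ->
  (m1 \x m2)%E.-integrable setT (fun z => (p z)%:E).
Proof.
move=> mp ia ib pab.
have mpE : measurable_fun setT (fun z => (p z)%:E) by exact/measurable_EFinP.
apply/(integrable12ltyP _ _ mpE).
have ma := measurable_int _ ia; have mb := measurable_int _ ib.
apply: (@le_lt_trans _ _ (\int[m1]_x (`|(a x)%:E| * \int[m2]_y `|(b y)%:E|))%E).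
  apply: ge0_le_integral => //.
  - by move=> x _; exact: integral_ge0.
  - apply: (measurable_fun_fubini_tonelli_F (m2 := m2) (fun z => `|(p z)%:E|%E)) => //.
    exact: measurableT_comp.
  - apply: emeasurable_funM; last exact: measurable_cst.
    exact: measurableT_comp.
  - move=> x _; rewrite -ge0_integralZl//; last exact: measurableT_comp.
    apply: ge0_le_integral => //.
    + apply/measurable_EFinP; apply: measurableT_comp => //.
      exact: measurableT_comp mp _.
    + by apply: emeasurable_funM => //; exact: measurableT_comp.
    + move=> y _; rewrite !abse_EFin -EFinM lee_fin (le_trans (pab x y))//.
      by rewrite -normrM ler_norm.
rewrite ge0_integralZr//; last 2 first.
- exact: measurableT_comp.
- exact: integral_ge0.
have /integrableP[_ ha] := ia; have /integrableP[_ hb] := ib.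
apply: lte_mul_pinfty => //; first exact: integral_ge0.
by rewrite ge0_fin_numE//; exact: integral_ge0.
Qed.

Lemma Rintegral_fubini (p : T1 * T2 -> R) :
  (m1 \x m2)%E.-integrable setT (fun z => (p z)%:E) ->
  (forall x, m2.-integrable setT (fun y => (p (x, y))%:E)) ->
  (forall y, m1.-integrable setT (fun x => (p (x, y))%:E)) ->
  (\int[m1]_x \int[m2]_y p (x, y))%R = (\int[m2]_y \int[m1]_x p (x, y))%R.
Proof.
move=> ip i2 i1; rewrite /Rintegral; congr fine.
transitivity (\int[m1]_x \int[m2]_y (p (x, y))%:E)%E.
  by apply: eq_integral => x _; rewrite fineK//; exact: integrable_fin_num.
rewrite (Fubini ip).
by apply: eq_integral => y _; rewrite fineK//; exact: integrable_fin_num.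
Qed.

(** Fubini for two integrable functions coupled by a bounded measurable kernel.
    Since [k] is bounded, both inner integrals converge at every point, so the
    statement needs no almost-everywhere clause. *)
Lemma cint_fubini (phi : T1 -> R[i]) (psi : T2 -> R[i]) (k : T1 * T2 -> R[i])
    (C : R) :
  cintble m1 phi -> cintble m2 psi -> cmeasurable k ->
  (forall z, norm1 (k z) <= C) ->
  cint m1 (fun x => phi x * cint m2 (fun y => psi y * k (x, y))) =
  cint m2 (fun y => psi y * cint m1 (fun x => phi x * k (x, y))).
Proof.
move=> iphi ipsi mk kC.
have mk1 y : cmeasurable (fun x => k (x, y)) by apply: (cmeasurable_comp mk).
have mk2 x : cmeasurable (fun y => k (x, y)) by apply: (cmeasurable_comp mk).
have ik1 y : cintble m1 (fun x => phi x * k (x, y)) by exact: cintbleM (mk1 y) _.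
have ik2 x : cintble m2 (fun y => psi y * k (x, y)) by exact: cintbleM (mk2 x) _.
pose H z := phi z.1 * (psi z.2 * k z).
have mH : cmeasurable H.
  apply: cmeasurableM.
    by apply: (cmeasurable_comp (cintble_measurable iphi)).
  apply: cmeasurableM => //.
  by apply: (cmeasurable_comp (cintble_measurable ipsi)).
have H1 x y : psi y * (phi x * k (x, y)) = H (x, y) by rewrite /H mulrCA.
have iH2 x : cintble m2 (fun y => H (x, y)).
  by apply: (@cintbleZ _ _ _ _ (phi x) (fun y => psi y * k (x, y))).
have iH1 y : cintble m1 (fun x => H (x, y)).
  by under eq_fun do rewrite -H1;
    apply: (@cintbleZ _ _ _ _ (psi y) (fun x => phi x * k (x, y))).
under eq_fun do rewrite -cintZ//.
under [in RHS]eq_fun do (rewrite -cintZ//; under eq_fun do rewrite H1).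
have Hle x y : norm1 (H (x, y)) <= C * norm1 (phi x) * norm1 (psi y).
  rewrite /H/= mulrA; apply: (le_trans (norm1M _ _)).
  rewrite -mulrA mulrC; apply: ler_pM; rewrite ?norm1_ge0//.
  exact: norm1M.
have ia : m1.-integrable setT (fun x => (C * norm1 (phi x))%:E).
  by under eq_fun do rewrite EFinM; apply: integrableZl => //; exact: cintble_norm1.
have ib := cintble_norm1 ipsi.
rewrite /cint /=; congr (_ +i* _).
  apply: (@Rintegral_fubini (fun z => Re (H z))).
  - apply: (integrable_prod_dominated (proj1 mH) ia ib) => x y.
    exact: le_trans (le_Re_norm1 _) (Hle _ _).
  - by move=> x; case: (iH2 x).
  - by move=> y; case: (iH1 y).
apply: (@Rintegral_fubini (fun z => Im (H z))).
- apply: (integrable_prod_dominated (proj2 mH) ia ib) => x y.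
  exact: le_trans (le_Im_norm1 _) (Hle _ _).
- by move=> x; case: (iH2 x).
- by move=> y; case: (iH1 y).
Qed.

End complex_fubini.

(** * Affine change of variables in R^n *)

Section affine_change_of_variables.
Context {R : realType}.
Local Notation mR := (measurableTypeR R).
Local Notation leb := (@lebesgue_measure R).

Lemma measurable_affine (a c : R) :
  measurable_fun setT ((fun x => a + c * x) : mR -> mR).
Proof.
by apply: measurable_funD; [exact: measurable_cst|apply: measurable_funM => //].
Qed.

(** Translation invariance and scaling of the Lebesgue measure; both sides agree on
    half-open intervals, whose preimages depend on the sign of [c]. *)
Lemma lebesgue_measure_affine (a c : R) (X : set mR) : c != 0 -> measurable X ->
  (`|c|%:E * leb ((fun x => a + c * x)%R @^-1` X))%E = leb X.
Proof.
move=> c0 mX.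
pose phi : mR -> mR := fun x => a + c * x.
pose nu : {measure set mR -> \bar R} :=
  @measure_function_pushforward__canonical__measure_function_Measure
    _ _ _ _ R leb phi (measurable_affine a c).
pose r : {nonneg R} := NngNum (normr_ge0 c).
have nuE A : mscale r nu A = (`|c|%:E * leb (phi @^-1` A))%E by [].
rewrite -nuE; apply/esym.
apply: lebesgue_measure_unique => // _ [[x y] _ <-].
transitivity (`|c|%:E * leb (phi @^-1` `]x, y]))%E => //; rewrite /phi.
have [c_lt0|c_gt0|c00] := ltgtP c 0; last by rewrite c00 eqxx in c0.
- rewrite (_ : _ @^-1` _ = `[(y - a) / c, (x - a) / c[%classic); last first.
    apply/seteqP; split => t /=; rewrite !in_itv/=.
      by move=> /andP[h1 h2]; rewrite ler_ndivrMr// ltr_ndivlMr//; apply/andP; split; lra.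
    by rewrite ler_ndivrMr// ltr_ndivlMr// => /andP[h1 h2]; apply/andP; split; lra.
  rewrite !lebesgue_measure_itv/= !lte_fin ltr_nM2r ?invr_lt0// ltrD2r.
  case: ifPn => xy; last by rewrite mule0.
  by rewrite -!EFinB -EFinM ltr0_norm//; congr EFin; field.
- rewrite (_ : _ @^-1` _ = `](x - a) / c, (y - a) / c]%classic); last first.
    apply/seteqP; split => t /=; rewrite !in_itv/=.
      by move=> /andP[h1 h2]; rewrite ler_pdivlMr// ltr_pdivrMr//; apply/andP; split; lra.
    by rewrite ler_pdivlMr// ltr_pdivrMr// => /andP[h1 h2]; apply/andP; split; lra.
  rewrite !lebesgue_measure_itv/= !lte_fin ltr_pM2r ?invr_gt0// ltrD2r.
  case: ifPn => xy; last by rewrite mule0.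
  by rewrite -!EFinB -EFinM gtr0_norm//; congr EFin; field.
Qed.

Lemma ge0_integral_affine1 (a c : R) (h : mR -> \bar R) : c != 0 ->
  measurable_fun setT h -> (forall x, (0 <= h x)%E) ->
  (`|c|%:E * \int[leb]_x h (a + c * x)%R)%E = (\int[leb]_x h x)%E.
Proof.
move=> c0 mh h0.
pose phi : mR -> mR := fun x => a + c * x.
have mphi : measurable_fun setT phi by exact: measurable_affine.
pose nu : {measure set mR -> \bar R} :=
  @measure_function_pushforward__canonical__measure_function_Measure
    _ _ _ _ R leb phi mphi.
pose r : {nonneg R} := NngNum (normr_ge0 c).
transitivity (\int[mscale r nu]_x h x)%E; last first.
  by apply: eq_measure_integral => A mA _; exact: (lebesgue_measure_affine a c0 mA).
rewrite ge0_integral_mscale//; congr (_ * _)%E.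
by rewrite /nu /= ge0_integral_pushforward.
Qed.

(** The map t |-> a + c t on tuples. *)
Definition affine_tuple n (a : 'I_n -> R) (c : R) (t : n.-tuple mR) : n.-tuple mR :=
  [tuple a i + c * tnth t i | i < n].

Lemma measurable_affine_tuple n (a : 'I_n -> R) c :
  measurable_fun setT (affine_tuple a c).
Proof.
apply/measurable_fun_tnthP => i; rewrite /comp.
under eq_fun do rewrite tnth_mktuple.
apply: (measurableT_comp (measurable_affine (a i) c)).
exact: measurable_tnth.
Qed.

Lemma affine_tuple_cons n (a : 'I_n.+1 -> R) c (x : mR) (t : n.-tuple mR) :
  affine_tuple a c (tcons (x, t)) =
  tcons ((a ord0 + c * x)%R : mR, affine_tuple (fun i => a (lift ord0 i)) c t).
Proof.
apply: eq_from_tnth => i; rewrite tnth_mktuple.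
by case: (unliftP ord0 i) => [j ->|->] //; rewrite !tnthS tnth_mktuple.
Qed.

(** Change of variables t |-> a + c t in R^n for nonnegative functions, by induction
    on the dimension through Tonelli. *)
Lemma ge0_integral_affine n (a : 'I_n -> R) (c : R) (h : n.-tuple mR -> \bar R) :
  c != 0 -> measurable_fun setT h -> (forall x, (0 <= h x)%E) ->
  ((`|c| ^+ n)%:E * \int[lebesgueN n]_t h (affine_tuple a c t))%E =
  (\int[lebesgueN n]_t h t)%E.
Proof.
move=> c0; elim: n => [|n IH] in a h * => mh h0.
  rewrite expr0 mul1e; apply: eq_integral => t _; congr h.
  by apply: eq_from_tnth => -[].
have mtc (k : n.+1.-tuple mR -> \bar R) : measurable_fun setT k ->
    measurable_fun setT (fun z => k (@tcons R n z)).
  by move=> mk; apply: (measurableT_comp mk); exact: measurable_tcons.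
have step (k : n.+1.-tuple mR -> \bar R) : measurable_fun setT k ->
    (forall t, (0 <= k t)%E) ->
    (\int[lebesgueN n.+1]_t k t = \int[leb]_x \int[lebesgueN n]_t k (tcons (x, t)))%E.
  move=> mk k0.
  transitivity (\int[pushforward (leb \x lebesgueN n)%E (@tcons R n)]_t k t)%E.
    by [].
  rewrite (ge0_integral_pushforward (@measurable_tcons R n))//.
  rewrite preimage_setT (fubini_tonelli1 (m1 := leb) (m2 := lebesgueN n)
    (k \o @tcons R n) (mtc k mk))//.
  by move=> z; exact: k0.
have mha : measurable_fun setT (fun t => h (affine_tuple a c t)).
  by apply: (measurableT_comp mh); exact: measurable_affine_tuple.
rewrite step// [RHS]step//.
set a' := fun i => a (lift ord0 i).
pose F x := (\int[lebesgueN n]_t h (tcons (x, t)))%E.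
have mF : measurable_fun setT F.
  apply: (measurable_fun_fubini_tonelli_F (m2 := lebesgueN n)
    (fun z => h (tcons z))) => //; exact: mtc.
have F0 x : (0 <= F x)%E by exact: integral_ge0.
rewrite -(ge0_integral_affine1 (a ord0) c0 mF F0) exprS EFinM -muleA.
congr (_ * _)%E; rewrite -ge0_integralZl//.
- apply: eq_integral => x _; rewrite /F -[RHS](IH a')//.
    by congr (_ * _)%E; apply: eq_integral => t _; rewrite affine_tuple_cons.
  by apply: (measurableT_comp (mtc _ mh)).
- by apply: (measurable_fun_fubini_tonelli_F (m2 := lebesgueN n)
    (fun z => h (affine_tuple a c (tcons z))) (mtc _ mha)).
- by move=> x _; exact: integral_ge0.
Qed.

Lemma integrable_affine n (a : 'I_n -> R) (c : R) (h : n.-tuple mR -> R) :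
  c != 0 -> (lebesgueN n).-integrable setT (fun t => (h t)%:E) ->
  (lebesgueN n).-integrable setT (fun t => (h (affine_tuple a c t))%:E).
Proof.
move=> c0 /integrableP[mh hoo]; apply/integrableP; split.
  by apply: (measurableT_comp mh); exact: measurable_affine_tuple.
(* If the integral were infinite, so would be its multiple by |c|^n > 0. *)
rewrite ltNge leye_eq; apply/negP => /eqP oo; move: hoo.
rewrite -(@ge0_integral_affine n a c)//; last exact: measurableT_comp.
by rewrite oo gt0_muley ?ltxx// lte_fin exprn_gt0// normr_gt0.
Qed.

Lemma Rintegral_affine n (a : 'I_n -> R) (c : R) (h : n.-tuple mR -> R) :
  c != 0 -> (lebesgueN n).-integrable setT (fun t => (h t)%:E) ->
  `|c| ^+ n * (\int[lebesgueN n]_t h (affine_tuple a c t))%R =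
  (\int[lebesgueN n]_t h t)%R.
Proof.
move=> c0 ih; have iha := integrable_affine a c0 ih.
have mh := measurable_int _ ih.
rewrite -RintegralZl// /Rintegral; congr fine.
under eq_integral do rewrite EFinM.
rewrite integralZl// integralE [RHS]integralE.
pose hE t := (h t)%:E.
rewrite -[in RHS](@ge0_integral_affine n a c (hE^\+)%E)//;
  last exact: measurable_funepos.
rewrite -[in RHS](@ge0_integral_affine n a c (hE^\-)%E)//;
  last exact: measurable_funeneg.
rewrite muleBr//.
  by congr (_ * _ - _ * _)%E; apply: eq_integral => t _;
    rewrite ?funeposE ?funenegE.
exact: (integrable_add_def measurableT iha).
Qed.

End affine_change_of_variables.

(** * Fourier transforms on row vectors *)

Section row_vectors.
Context {R : realType} {n : nat}.
Local Notation mR := (measurableTypeR R).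
Implicit Types (h K p : 'rV[R]_n -> R[i]) (X : 'M[R]_n) (t u v w : 'rV[R]_n).

(** Measurability of a function of a row vector, for the product sigma-algebra
    carried by the tuple of its coordinates. *)
Definition row_measurable h :=
  cmeasurable (fun t : n.-tuple mR => h (row_of_tuple t)).

Lemma cintegrable_measurable h : cintegrable h -> row_measurable h.
Proof. by move=> /cintble_measurable. Qed.

Lemma row_of_affine_tuple v (c : R) (t : n.-tuple mR) :
  row_of_tuple (affine_tuple (fun i => v ord0 i) c t) = v + c *: row_of_tuple t.
Proof. by apply/rowP => i; rewrite !mxE tnth_mktuple. Qed.

Lemma row_measurable_affine v (c : R) h :
  row_measurable h -> row_measurable (fun t => h (v + c *: t)).
Proof.
move=> mh; rewrite /row_measurable.
under eq_fun do rewrite -row_of_affine_tuple.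
apply: (cmeasurable_comp mh); exact: measurable_affine_tuple.
Qed.

Lemma cintegrable_affine v (c : R) h : c != 0 -> cintegrable h ->
  cintegrable (fun t => h (v + c *: t)).
Proof.
move=> c0 [h1 h2]; split; under eq_fun do rewrite -row_of_affine_tuple.
  exact: (integrable_affine _ c0 h1).
exact: (integrable_affine _ c0 h2).
Qed.

Lemma cintegral_affine v (c : R) h : c != 0 -> cintegrable h ->
  (`|c| ^+ n)%:C * cintegral (fun t => h (v + c *: t)) = cintegral h.
Proof.
move=> c0 [h1 h2]; apply/eqP; rewrite eq_complex cReM cImM /= !mul0r subr0 addr0.
apply/andP; split; apply/eqP.
  under eq_Rintegral do rewrite -row_of_affine_tuple.
  exact: (Rintegral_affine _ c0 h1).
under eq_Rintegral do rewrite -row_of_affine_tuple.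
exact: (Rintegral_affine _ c0 h2).
Qed.

Lemma bformDr X u t v : bform X u (t + v) = bform X u t + bform X u v.
Proof. by rewrite /bform linearD /= mulmxDr mxE. Qed.

Lemma bformZr X (c : R) u t : bform X u (c *: t) = c * bform X u t.
Proof. by rewrite /bform linearZ /= -scalemxAr mxE. Qed.

Lemma bform_tr X u t : bform X^T u t = bform X t u.
Proof.
have -> : bform X t u = (u *m X^T *m t^T)^T ord0 ord0.
  by rewrite !trmx_mul !trmxK mulmxA.
by rewrite mxE.
Qed.

Lemma bformDl X u t v : bform X (u + t) v = bform X u v + bform X t v.
Proof. by rewrite -bform_tr bformDr !bform_tr. Qed.

Lemma bformZl X (c : R) u t : bform X (c *: u) t = c * bform X u t.
Proof. by rewrite -bform_tr bformZr bform_tr. Qed.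

Lemma bformN X u t : bform (- X) u t = - bform X u t.
Proof. by rewrite /bform mulmxN mulNmx mxE. Qed.

Lemma bformZ X (c : R) u t : bform (c *: X) u t = c * bform X u t.
Proof. by rewrite /bform -scalemxAr -scalemxAl mxE. Qed.

Lemma bformB X Y u t : bform (X - Y) u t = bform X u t - bform Y u t.
Proof. by rewrite /bform mulmxBr mulmxBl !mxE. Qed.

Lemma measurable_bform d (T : measurableType d) X (p q : T -> 'rV[R]_n) :
  (forall i, measurable_fun setT (fun z => p z ord0 i)) ->
  (forall i, measurable_fun setT (fun z => q z ord0 i)) ->
  measurable_fun setT (fun z => bform X (p z) (q z)).
Proof.
move=> mp mq; rewrite /bform; under eq_fun do rewrite mxE.
apply: measurable_sum => j; apply: measurable_funM.
  under eq_fun do rewrite mxE.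
  by apply: measurable_sum => i; apply: measurable_funM.
by under eq_fun do rewrite mxE; exact: mq.
Qed.

Lemma measurable_row_of_tuple d (T : measurableType d) (p : T -> n.-tuple mR) i :
  measurable_fun setT p ->
  measurable_fun setT (fun z => row_of_tuple (p z) ord0 i : mR).
Proof.
move=> mp; under eq_fun do rewrite mxE.
exact: (measurableT_comp (measurable_tnth i) mp).
Qed.

Lemma row_measurable_expi_bform X v :
  row_measurable (fun t => expi (bform X t v)).
Proof.
apply: cmeasurable_expi; apply: measurable_bform => i; last exact: measurable_cst.
exact: measurable_row_of_tuple.
Qed.

Lemma row_measurable_expi_quad (c : R) X :
  row_measurable (fun t => expi (c * bform X t t)).
Proof.
apply: cmeasurable_expi; apply: measurable_funM; first exact: measurable_cst.
by apply: measurable_bform => i; exact: measurable_row_of_tuple.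
Qed.

Lemma cintegrableM h K (C : R) : cintegrable h -> row_measurable K ->
  (forall t, norm1 (K t) <= C) -> cintegrable (fun t => h t * K t).
Proof. by move=> ih mK KC; exact: (cintbleM ih mK). Qed.

Lemma cintegralZ (c : R[i]) h : cintegrable h ->
  cintegral (fun t => c * h t) = c * cintegral h.
Proof. exact: cintZ. Qed.

(** Continuity along every line: K (v + e_k w) tends to K v whenever e_k tends to 0.
    This is all the continuity that the inversion theorem uses, and dominated
    convergence delivers it without any topology on row vectors. *)
Definition ray_continuous K := forall v w (e : nat -> R),
  e @ \oo --> 0 -> ccvg (fun k => K (v + e k *: w)) (K v).

Lemma ray_continuousM h K : ray_continuous h -> ray_continuous K ->
  ray_continuous (fun t => h t * K t).
Proof. by move=> ch cK v w e e0; apply: ccvgM; [exact: ch|exact: cK]. Qed.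

Lemma ray_continuous_cst (x : R[i]) : ray_continuous (fun=> x).
Proof. by move=> v w e _; exact: ccvg_cst. Qed.

Lemma cvg_bform_ray X t v w (e : nat -> R) : e @ \oo --> 0 ->
  (fun k => bform X t (v + e k *: w)) @ \oo --> bform X t v.
Proof.
move=> e0; under eq_fun do rewrite bformDr bformZr.
suff : (fun k => bform X t v + e k * bform X t w) @ \oo -->
    bform X t v + 0 * bform X t w by rewrite mul0r addr0.
by apply: cvgD; [exact: cvg_cst|exact: cvgMr_tmp].
Qed.

Lemma ray_continuous_expi_quad (c : R) X :
  ray_continuous (fun t => expi (c * bform X t t)).
Proof.
move=> v w e e0; apply: ccvg_expi; apply: cvgMr.
under eq_fun do rewrite bformDl bformZl.
suff : (fun k => bform X v (v + e k *: w) + e k * bform X w (v + e k *: w)) @ \oo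
    --> bform X v v + 0 * bform X w v by rewrite mul0r addr0.
apply: cvgD; first exact: cvg_bform_ray.
by apply: cvgM => //; exact: cvg_bform_ray.
Qed.

(** The Fourier transform with kernel exp (i t X v^T). The matrix [- X^T] gives the
    conjugate kernel with the two variables exchanged: for X = - 2 pi B^{-1}, the
    inverse transform up to a constant. *)
Definition fourier X h v : R[i] :=
  cintegral (fun t => h t * expi (bform X t v)).

Lemma fourierZ X (c : R[i]) h v : cintegrable h ->
  fourier X (fun t => c * h t) v = c * fourier X h v.
Proof.
move=> ih; rewrite /fourier; under eq_fun do rewrite -mulrA.
apply: cintegralZ; apply: cintegrableM ih _ _.
  exact: row_measurable_expi_bform.
by move=> t; exact: norm1_expi.
Qed.

Lemma integrable_2norm1 h : cintegrable h -> (lebesgueN n).-integrable setT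
  (fun t : n.-tuple mR => (2 * norm1 (h (row_of_tuple t)))%:E).
Proof.
move=> ih; under eq_fun do rewrite EFinM.
by apply: integrableZl => //; exact: (cintble_norm1 ih).
Qed.

Lemma fourier_bounded X h : cintegrable h ->
  exists C, forall v, norm1 (fourier X h v) <= C.
Proof.
move=> ih; exists (\int[lebesgueN n]_t (2 * norm1 (h (row_of_tuple t))))%R => v.
have ihe : cintegrable (fun t => h t * expi (bform X t v)).
  apply: (cintegrableM ih); first exact: row_measurable_expi_bform.
  by move=> t; exact: norm1_expi.
apply: (le_trans (norm1_cint ihe)); apply: le_Rintegral => //.
- exact: (cintble_norm1 ihe).
- exact: integrable_2norm1.
- move=> t _; rewrite [leRHS]mulrC; apply: (le_trans (norm1M _ _)).
  by apply: ler_wpM2l; rewrite ?norm1_ge0 ?norm1_expi.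
Qed.

Lemma fourier_continuous X h : cintegrable h -> ray_continuous (fourier X h).
Proof.
move=> ih v w e e0.
have mh := cintegrable_measurable ih.
apply: (@cint_dominated_cvg _ _ _ _ _ _
  (fun t : n.-tuple mR => 2 * norm1 (h (row_of_tuple t)))).
- by move=> k; apply: cmeasurableM => //; exact: row_measurable_expi_bform.
- by apply: cmeasurableM => //; exact: row_measurable_expi_bform.
- move=> t; apply: ccvgM; first exact: ccvg_cst.
  by apply: ccvg_expi; exact: cvg_bform_ray.
- exact: integrable_2norm1.
- move=> k t; rewrite [leRHS]mulrC; apply: (le_trans (norm1M _ _)).
  by apply: ler_wpM2l; rewrite ?norm1_ge0 ?norm1_expi.
Qed.

(** The multiplication formula: the Fourier transform moves from one factor to the
    other under the integral. *)
Lemma cintegral_fubini_fourier X h K : cintegrable h -> cintegrable K ->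
  cintegral (fun t => h t * fourier X K t) =
  cintegral (fun w => K w * fourier X^T h w).
Proof.
move=> ih iK; rewrite /fourier.
under [in RHS]eq_fun do under eq_fun do rewrite bform_tr.
pose k (z : n.-tuple mR * n.-tuple mR) :=
  expi (bform X (row_of_tuple z.2) (row_of_tuple z.1)).
apply: (@cint_fubini _ _ _ _ _ _ _ _ _ k 2 ih iK).
  apply: cmeasurable_expi; apply: measurable_bform => i;
    exact: measurable_row_of_tuple.
by move=> z; exact: norm1_expi.
Qed.

End row_vectors.

(** * Fourier inversion *)

Section fourier_inversion.
Context {R : realType} {n : nat}.
Local Notation mR := (measurableTypeR R).
Variables (X : 'M[R]_n) (K p : 'rV[R]_n -> R[i]) (C : R) (c : R[i]).
Hypotheses (iK : cintegrable K) (KC : forall w, norm1 (K w) <= C)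
  (cK : ray_continuous K) (iZ : cintegrable (fourier (- X^T) K))
  (ip : cintegrable p) (iP : cintegrable (fourier X p))
  (pE : forall t, p t = c * fourier (- X^T) (fourier X p) t).
Local Notation Z := (fourier (- X^T) K).
Local Notation P := (fourier X p).

(** [Z] is integrated against the transform kernel damped by p (s + e t). The result
    is an average of [K] near [v] with a weight that does not depend on [e]. *)
Lemma fourier_regularization s v (e : R) : e != 0 ->
  cintegral (fun t => Z t * (p (s + e *: t) * expi (bform X t v))) =
  cintegral (fun y => K (v - e *: y) * (P y * expi (bform (- X^T) y s))).
Proof.
move=> e0.
pose phi t := p (s + e *: t) * expi (bform X t v).
have ips : cintegrable (fun t => p (s + e *: t)) by exact: cintegrable_affine.
have iphi : cintegrable phi.
  apply: (cintegrableM ips); first exact: row_measurable_expi_bform.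
  by move=> t; exact: norm1_expi.
pose Q y := P y * expi (bform (- X^T) y s).
pose r : R[i] := (`|e| ^+ n)%:C.
have r0 : r != 0.
  by rewrite /r eq_complex /= eqxx andbT expf_neq0// normr_eq0.
(* Substitution t' = s + e t. *)
have phiE w : fourier (- X) phi w = r^-1 * Q (e^-1 *: (v - w)).
  set y := e^-1 *: (v - w).
  have ih : cintegrable (fun t => p t * expi (bform X t y)).
    apply: (cintegrableM ip); first exact: row_measurable_expi_bform.
    by move=> t; exact: norm1_expi.
  apply: (mulfI r0); rewrite mulrA divff// mul1r /Q mulrC.
  rewrite [RHS]mulrC -cintegralZ//.
  rewrite -(cintegral_affine s e0); last exact: cintbleZ.
  rewrite mulrC; congr (_ * cintegral _); apply/funext => t.
  rewrite /phi mulrCA -mulrA; congr (_ * _); rewrite -!expiD; congr expi.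
  rewrite !bformN bform_tr bformDl bformZl /y !bformZr !bformDr.
  rewrite -(scaleN1r w) !bformZr.
  by field.
under eq_fun do rewrite mulrC.
rewrite cintegral_fubini_fourier// linearN /= trmxK.
under eq_fun do rewrite phiE.
have [C' QC] := fourier_bounded X ip.
have mQ : row_measurable Q.
  apply: cmeasurableM; first exact: (cintegrable_measurable iP).
  exact: row_measurable_expi_bform.
have ih : cintegrable (fun w => K w * (r^-1 * Q (e^-1 *: (v - w)))).
  apply: (@cintegrableM _ _ _ _ (norm1 r^-1 * (C' * 2)) iK).
    apply: cmeasurableM; first exact: cmeasurable_cst.
    have := row_measurable_affine (e^-1 *: v) (- e^-1) mQ.
    rewrite (_ : (fun _ => _) = fun w => Q (e^-1 *: (v - w)))//.
    by apply/funext => w; rewrite scalerBr scaleNr.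
  move=> w; apply: (le_trans (norm1M _ _)); apply: ler_wpM2l.
    exact: norm1_ge0.
  by apply: (le_trans (norm1M _ _)); apply: ler_pM; rewrite ?norm1_ge0 ?norm1_expi.
(* Substitution w = v - e y. *)
have ne0 : - e != 0 by rewrite oppr_eq0.
rewrite -(cintegral_affine v ne0 ih) normrN -/r.
rewrite -cintegralZ; last exact: (cintegrable_affine v ne0 ih).
congr cintegral; apply/funext => y.
rewrite scaleNr opprD addrA subrr add0r opprK scalerA mulVf// scale1r.
by rewrite mulrCA (mulrA r) divff// mul1r.
Qed.

(** Fourier inversion for an integrable, bounded, line-continuous [K] whose inverse
    transform [Z] is integrable, given a single nonzero test function [p] for which
    inversion is known. The dilations of [p] about a point [s] where it does not
    vanish form the approximate identity. *)
Lemma fourier_inversion s v : p s != 0 -> c * fourier X Z v = K v.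
Proof.
move=> ps0.
pose e (k : nat) : R := k.+1%:R^-1.
have e0 : e @ \oo --> 0 by exact: cvg_harmonic.
have en0 k : e k != 0 by rewrite invr_eq0 pnatr_eq0.
have [Cp pC] : exists Cp, forall t, norm1 (p t) <= Cp.
  have [C' PC] := fourier_bounded (- X^T) iP.
  exists (norm1 c * C') => t; rewrite pE; apply: (le_trans (norm1M _ _)).
  by apply: ler_wpM2l; [exact: norm1_ge0|exact: PC].
have cp : ray_continuous p.
  have -> : p = fun t => c * fourier (- X^T) P t by apply/funext.
  by apply: ray_continuousM; [exact: ray_continuous_cst|exact: fourier_continuous].
have mp := cintegrable_measurable ip.
have mK := cintegrable_measurable iK.
have mZ := cintegrable_measurable iZ.
have mP := cintegrable_measurable iP.
have C0 : 0 <= C by rewrite (le_trans _ (KC 0)) ?norm1_ge0.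
have Cp0 : 0 <= Cp by rewrite (le_trans _ (pC 0)) ?norm1_ge0.
pose I k := cintegral (fun t => Z t * (p (s + e k *: t) * expi (bform X t v))).
(* As e_k tends to 0 the damping factor tends to the constant p s. *)
have lim1 : ccvg I (p s * fourier X Z v).
  rewrite /fourier -cintegralZ; last first.
    apply: (cintegrableM iZ); first exact: row_measurable_expi_bform.
    by move=> t; exact: norm1_expi.
  apply: (@cint_dominated_cvg _ _ _ _ _ _
    (fun t : n.-tuple mR => Cp * (2 * norm1 (Z (row_of_tuple t))))).
  - move=> k; apply: cmeasurableM => //; apply: cmeasurableM.
      exact: (row_measurable_affine s (e k) mp).
    exact: row_measurable_expi_bform.
  - apply: cmeasurableM; first exact: cmeasurable_cst.
    by apply: cmeasurableM => //; exact: row_measurable_expi_bform.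
  - move=> t; rewrite [X in ccvg _ X]mulrCA; apply: ccvgM; first exact: ccvg_cst.
    by apply: ccvgM; [exact: cp|exact: ccvg_cst].
  - under eq_fun do rewrite EFinM.
    by apply: integrableZl => //; exact: integrable_2norm1.
  - move=> k t; apply: (le_trans (norm1M _ _)); rewrite [leRHS]mulrA [leRHS]mulrC.
    apply: ler_wpM2l; first exact: norm1_ge0.
    by apply: (le_trans (norm1M _ _)); apply: ler_pM; rewrite ?norm1_ge0 ?norm1_expi.
(* After regularization K (v - e_k y) tends to K v. *)
have lim2 : ccvg I (K v * fourier (- X^T) P s).
  have -> : I = fun k => cintegral
      (fun y => K (v - e k *: y) * (P y * expi (bform (- X^T) y s))).
    by apply/funext => k; exact: fourier_regularization.
  rewrite /fourier -cintegralZ; last first.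
    apply: (cintegrableM iP); first exact: row_measurable_expi_bform.
    by move=> t; exact: norm1_expi.
  apply: (@cint_dominated_cvg _ _ _ _ _ _
    (fun t : n.-tuple mR => C * (2 * norm1 (P (row_of_tuple t))))).
  - move=> k; apply: cmeasurableM.
      have := row_measurable_affine v (- e k) mK.
      rewrite (_ : (fun _ => _) = fun y => K (v - e k *: y))//.
      by apply/funext => y; rewrite scaleNr.
    by apply: cmeasurableM => //; exact: row_measurable_expi_bform.
  - apply: cmeasurableM; first exact: cmeasurable_cst.
    by apply: cmeasurableM => //; exact: row_measurable_expi_bform.
  - move=> t; apply: ccvgM; last exact: ccvg_cst.
    under eq_fun do rewrite -scalerN; exact: cK.
  - under eq_fun do rewrite EFinM.
    by apply: integrableZl => //; exact: integrable_2norm1.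
  - move=> k t; apply: (le_trans (norm1M _ _)).
    apply: ler_pM; rewrite ?norm1_ge0 ?KC//.
    rewrite [leRHS]mulrC; apply: (le_trans (norm1M _ _)).
    by apply: ler_wpM2l; rewrite ?norm1_ge0 ?norm1_expi.
(* The hypothesis on [p] turns c times the inverse transform of [P] at s into p s. *)
apply: (mulfI ps0); rewrite mulrCA (ccvg_unique lim1 lim2) mulrCA -pE.
exact: mulrC.
Qed.

End fourier_inversion.

(** * The free metaplectic transformation in Fourier form *)

Section free_metaplectic.
Context {R : realType} {N : nat}.
Variable M : 'M[R]_(N + N).
Implicit Types (f g H h : 'rV[R]_N -> R[i]) (t u tau : 'rV[R]_N).

(** The normalizing constant |det B|^(-1/2). *)
Definition fmt_const : R[i] := ((Num.sqrt `|\det (mxB M)|)^-1)%:C.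

(** The matrix - 2 pi B^(-1): the oscillating factor of the FMT is the kernel of
    [fourier fmt_mx]. *)
Definition fmt_mx : 'M[R]_N := (- (2 * pi)) *: iB M.

(** The chirp e^{i c t B^{-1} A t^T} in the signal variable; the FMT uses c = pi, its
    inverse c = - pi. *)
Definition chirp_t (c : R) t := expi (c * bform (iB M *m mxA M) t t).

(** The chirp e^{i c u D B^{-1} u^T} in the spectral variable. *)
Definition chirp_u (c : R) u := expi (c * bform (mxD M *m iB M) u u).

Local Notation c0 := fmt_const.
Local Notation X := fmt_mx.

Lemma fmt_constM : c0 * c0 = (`|\det (mxB M)|^-1)%:C.
Proof.
rewrite /fmt_const -rmorphM /= -invfM -expr2 sqr_sqrtr//.
Qed.

Lemma fmt_const_neq0 : \det (mxB M) != 0 -> c0 != 0.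
Proof.
move=> d0; apply/eqP => /(congr1 (fun x => x * x)); rewrite fmt_constM mulr0.
by move/eqP; rewrite eq_complex /= eqxx andbT invr_eq0 normr_eq0 (negbTE d0).
Qed.

Lemma chirp_tN c t : chirp_t c t * chirp_t (- c) t = 1.
Proof. by rewrite -expiD -mulrDl subrr mul0r expi0. Qed.

Lemma chirp_uN c u : chirp_u c u * chirp_u (- c) u = 1.
Proof. by rewrite -expiD -mulrDl subrr mul0r expi0. Qed.

Lemma bform_AiBT t : bform ((mxA M)^T *m iBT M) t t = bform (iB M *m mxA M) t t.
Proof. by rewrite /iBT -trmx_mul bform_tr. Qed.

Lemma bform_iBTD u : bform (iBT M *m (mxD M)^T) u u = bform (mxD M *m iB M) u u.
Proof. by rewrite /iBT -trmx_mul bform_tr. Qed.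

Lemma bform_iBT t u : bform (iBT M) u t = bform (iB M) t u.
Proof. exact: bform_tr. Qed.

Lemma bform_fmt_mx t u : bform X t u = - (2 * pi * bform (iB M) t u).
Proof. by rewrite bformZ mulNr. Qed.

Lemma bform_ifmt_mx u t : bform (- X^T) u t = 2 * pi * bform (iB M) t u.
Proof. by rewrite bformN bform_tr bform_fmt_mx opprK. Qed.

(** A quadratic form only sees the symmetric part of its matrix, so the factor [Efac]
    is 1 whatever the blocks of [M] are. *)
Lemma Efac_eq1 t u : Efac M t u = 1.
Proof.
by rewrite /Efac !bformB bform_iBTD bform_AiBT bform_iBT !subrr !mulr0 subr0
   expi0 mulr1.
Qed.

Lemma cintegrable_chirp_t h c : cintegrable h ->
  cintegrable (fun t => h t * chirp_t c t).
Proof.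
move=> ih; apply: (cintegrableM ih); first exact: row_measurable_expi_quad.
by move=> t; exact: norm1_expi.
Qed.

Lemma cintegrable_chirp_u h c : cintegrable h ->
  cintegrable (fun u => h u * chirp_u c u).
Proof.
move=> ih; apply: (cintegrableM ih); first exact: row_measurable_expi_quad.
by move=> t; exact: norm1_expi.
Qed.

Lemma cintegrable_expi_bform Y h u : cintegrable h ->
  cintegrable (fun t => h t * expi (bform Y t u)).
Proof.
move=> ih; apply: (cintegrableM ih); first exact: row_measurable_expi_bform.
by move=> t; exact: norm1_expi.
Qed.

(** The FMT is a chirp times the Fourier transform of the chirped signal. *)
Lemma fmt_fourier f u : cintegrable f ->
  fmt M f u = c0 * (chirp_u pi u * fourier X (fun t => f t * chirp_t pi t) u).
Proof.
move=> iF; rewrite /fmt /fourier -/c0 -[in RHS]cintegralZ; last first.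
  exact/cintegrable_expi_bform/cintegrable_chirp_t.
congr (_ * cintegral _); apply/funext => t.
rewrite bform_fmt_mx; set E := expi (- _).
have -> : chirp_u pi u * (f t * chirp_t pi t * E) =
    f t * (chirp_u pi u * chirp_t pi t * E) by ring.
congr (_ * _); rewrite /E.
rewrite /chirp_u /chirp_t -!expiD.
by congr expi; ring.
Qed.

Lemma ifmt_fourier H t : cintegrable H ->
  ifmt M H t =
  c0 * (chirp_t (- pi) t * fourier (- X^T) (fun u => H u * chirp_u (- pi) u) t).
Proof.
move=> iH; rewrite /ifmt /fourier -/c0 -[in RHS]cintegralZ; last first.
  exact/cintegrable_expi_bform/cintegrable_chirp_u.
congr (_ * cintegral _); apply/funext => u.
rewrite bform_ifmt_mx; set E := expi (2 * _ * _).
have -> : chirp_t (- pi) t * (H u * chirp_u (- pi) u * E) =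
    H u * (chirp_t (- pi) t * chirp_u (- pi) u * E) by ring.
congr (_ * _); rewrite /E.
rewrite /chirp_u /chirp_t -!expiD.
by rewrite bform_iBTD bform_AiBT bform_iBT; congr expi; ring.
Qed.

(** As a function of [tau], the translate of [g] is a chirp times a Fourier transform,
    which is the form required by [cintegral_fubini_fourier]. *)
Lemma gtrans_fourier g t tau : cintegrable (fmt M g) ->
  gtrans M g t tau = c0 * c0 * (chirp_t pi tau * chirp_t (- pi) t *
    fourier X^T (fun u => fmt M g u * expi (bform (- X^T) u t)) tau).
Proof.
move=> iG; rewrite /gtrans /fourier -fmt_constM -[in RHS]cintegralZ; last first.
  exact/cintegrable_expi_bform/cintegrable_expi_bform.
congr (_ * cintegral _); apply/funext => u.
rewrite bform_ifmt_mx bform_tr bform_fmt_mx.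
set E1 := expi (2 * _ * _); set E2 := expi (- _).
have -> : chirp_t pi tau * chirp_t (- pi) t * (fmt M g u * E1 * E2) =
    fmt M g u * (chirp_t pi tau * chirp_t (- pi) t * E1 * E2) by ring.
congr (_ * _); rewrite /E1 /E2.
rewrite /chirp_u /chirp_t -!expiD.
rewrite -(scaleN1r tau) bformDl bformZl; congr expi; ring.
Qed.

Lemma gtrans_spec_fourier g u tau : cintegrable g ->
  gtrans_spec M g u tau = c0 * c0 * (chirp_u pi u * chirp_u (- pi) tau *
    fourier (- X) (fun t => g t * expi (bform X t u)) tau).
Proof.
move=> ig; rewrite /gtrans_spec /fourier -fmt_constM -[in RHS]cintegralZ; last first.
  exact/cintegrable_expi_bform/cintegrable_expi_bform.
congr (_ * cintegral _); apply/funext => t.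
rewrite bformN !bform_fmt_mx !bform_iBTD bform_iBT.
set E1 := expi (- (2 * pi * bform _ t u)); set E2 := expi (- - _).
have -> : chirp_u pi u * chirp_u (- pi) tau * (g t * E1 * E2) =
    g t * (chirp_u pi u * chirp_u (- pi) tau * E1 * E2) by ring.
congr (_ * _); rewrite /E1 /E2 /chirp_u -!expiD; congr expi.
by rewrite -(scaleN1r u) bformDr bformZr; ring.
Qed.

End free_metaplectic.

(** * The convolution theorem *)

Section convolution_theorem.
Context {R : realType} {N : nat}.
Variable M : 'M[R]_(N + N).
Hypothesis detB0 : \det (mxB M) != 0.
Variables f g : 'rV[R]_N -> R[i].
Hypotheses (Hf : is_signal M f) (Hg : is_signal M g).

Local Notation c0 := (fmt_const M).
Local Notation X := (fmt_mx M).
Local Notation F := (fmt M f).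
Local Notation G := (fmt M g).
Local Notation ch := (chirp_u M pi).
Local Notation ch' := (chirp_u M (- pi)).
Local Notation al := (chirp_t M pi).
Local Notation al' := (chirp_t M (- pi)).

Lemma fmt_bounded h : cintegrable h -> exists C, forall u, norm1 (fmt M h u) <= C.
Proof.
move=> ih; have [C hC] := fourier_bounded X (cintegrable_chirp_t M pi ih).
exists (norm1 c0 * (2 * C)) => u; rewrite fmt_fourier//.
apply: (le_trans (norm1M _ _)); apply: ler_wpM2l; first exact: norm1_ge0.
by apply: (le_trans (norm1M _ _)); apply: ler_pM; rewrite ?norm1_ge0 ?norm1_expi.
Qed.

Lemma fmt_ray_continuous h : cintegrable h -> ray_continuous (fmt M h).
Proof.
move=> ih.
have -> : fmt M h = fun u => c0 * (ch u * fourier X (fun t => h t * al t) u).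
  by apply/funext => u; exact: fmt_fourier.
apply: ray_continuousM; first exact: ray_continuous_cst.
apply: ray_continuousM; first exact: ray_continuous_expi_quad.
by apply: fourier_continuous; exact: cintegrable_chirp_t.
Qed.

(** The inversion formula of a signal, with the chirp of the signal variable moved to
    the left-hand side. *)
Lemma signal_chirp_fourier t : f t * al t =
  c0 * fourier (- X^T) (fun u => F u * ch' u) t.
Proof.
have [_ iF ->] := Hf; rewrite ifmt_fourier//.
set E := fourier _ _ _.
have -> : c0 * (al' t * E) * al t = al t * al' t * (c0 * E) by ring.
by rewrite chirp_tN mul1r.
Qed.

Lemma signal_bounded : exists C, forall t, norm1 (f t) <= C.
Proof.
have [_ iF fE] := Hf.
have [C hC] := fourier_bounded (- X^T) (cintegrable_chirp_u M (- pi) iF).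
exists (norm1 c0 * (2 * C)) => t; rewrite fE ifmt_fourier//.
apply: (le_trans (norm1M _ _)); apply: ler_wpM2l; first exact: norm1_ge0.
by apply: (le_trans (norm1M _ _)); apply: ler_pM; rewrite ?norm1_ge0 ?norm1_expi.
Qed.

(* The Fourier transform, up to a constant, of the chirped convolution. *)
Let K u := F u * G u * ch' u.

Let iFG : cintegrable (fun u => F u * G u).
Proof.
have [_ iF _] := Hf; have [ig iG _] := Hg; have [C GC] := fmt_bounded ig.
exact: (cintegrableM iF (cintegrable_measurable iG) GC).
Qed.

Let iK : cintegrable K.
Proof. exact: cintegrable_chirp_u. Qed.

Lemma fmconv_ifmt u0 t : fmconv M f g u0 t = ifmt M (fun u => F u * G u) t.
Proof.
have [iff iF _] := Hf; have [ig iG _] := Hg.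
pose c := c0 * c0 * al' t.
have ifa : cintegrable (fun t => f t * al t) by exact: cintegrable_chirp_t.
transitivity (cintegral (fun tau => c * (f tau * al tau) *
    fourier X^T (fun u => G u * expi (bform (- X^T) u t)) tau)).
  congr cintegral; apply/funext => tau.
  by rewrite Efac_eq1 mulr1 gtrans_fourier// /c; ring.
rewrite cintegral_fubini_fourier ?trmxK; last first.
- exact: cintegrable_expi_bform.
- exact: cintbleZ.
rewrite ifmt_fourier// mulrA /fourier -[in RHS]cintegralZ; last first.
  exact: cintegrable_expi_bform.
congr cintegral; apply/funext => u.
rewrite -/(fourier X (fun t => c * (f t * al t)) u) fourierZ//.
rewrite [in RHS]fmt_fourier// /c.
set P := fourier _ _ _; set E := expi _.
have -> : c0 * al' t * (c0 * (ch u * P) * G u * ch' u * E) =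
   ch u * ch' u * (c0 * c0 * al' t * P * G u * E) by ring.
by rewrite chirp_uN; ring.
Qed.

Lemma fmt_product u t0 : fmt M (fun t => f t * g t) u = fmconv_spec M f g t0 u.
Proof.
have [iff iF _] := Hf; have [ig iG _] := Hg.
have [C fC] := signal_bounded.
have ifg : cintegrable (fun t => f t * g t).
  under eq_fun do rewrite mulrC.
  exact: (cintegrableM ig (cintegrable_measurable iff) fC).
pose c := c0 * c0 * ch u.
rewrite fmt_fourier// mulrA /fourier -cintegralZ; last first.
  by apply: cintegrable_expi_bform; exact: cintegrable_chirp_t.
transitivity (cintegral (fun t => c * (g t * expi (bform X t u)) *
    fourier (- X^T) (fun u => F u * ch' u) t)).
  congr cintegral; apply/funext => t; set E := expi _.
  have -> : c0 * ch u * (f t * g t * al t * E) = c0 * ch u * g t * E * (f t * al t).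
    by ring.
  by rewrite signal_chirp_fourier /c; ring.
rewrite cintegral_fubini_fourier; last first.
- exact: cintegrable_chirp_u.
- by apply: cintbleZ; exact: cintegrable_expi_bform.
congr cintegral; apply/funext => tau.
rewrite linearN /= trmxK fourierZ; last exact: cintegrable_expi_bform.
by rewrite Efac_eq1 mulr1 gtrans_spec_fourier// /c; ring.
Qed.

Lemma fmt_fmconv u0 u : cintegrable (fmconv M f g u0) ->
  fmt M (fmconv M f g u0) u = F u * G u.
Proof.
move=> iz; have [iff iF _] := Hf; have [ig iG _] := Hg.
have cn0 := fmt_const_neq0 detB0.
pose p t := f t * al t.
pose P := fourier X p.
have ip : cintegrable p by exact: cintegrable_chirp_t.
have FE v : F v * ch' v = c0 * P v.
  rewrite fmt_fourier// -/p -/(P v).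
  have -> : c0 * (ch v * P v) * ch' v = ch v * ch' v * (c0 * P v) by ring.
  by rewrite chirp_uN mul1r.
have PE v : P v = c0^-1 * (F v * ch' v) by rewrite FE mulrA mulVf// mul1r.
have iP : cintegrable P.
  by rewrite (funext PE); apply: cintbleZ; exact: cintegrable_chirp_u.
have pE t : p t = c0 * c0 * fourier (- X^T) P t.
  by rewrite /p signal_chirp_fourier (funext FE) fourierZ// mulrA.
have zE t : fmconv M f g u0 t * al t = c0 * fourier (- X^T) K t.
  rewrite fmconv_ifmt ifmt_fourier//; set E := fourier _ _ _.
  have -> : c0 * (al' t * E) * al t = al t * al' t * (c0 * E) by ring.
  by rewrite chirp_tN mul1r.
have iZ : cintegrable (fourier (- X^T) K).
  have -> : fourier (- X^T) K = fun t => c0^-1 * (fmconv M f g u0 t * al t).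
    by apply/funext => t; rewrite zE mulrA mulVf// mul1r.
  by apply: cintbleZ; exact: cintegrable_chirp_t.
(* Fourier inversion for [K], tested against the chirped signal [p] itself; the
   degenerate case p = 0 gives K = 0. *)
have KE : c0 * c0 * fourier X (fourier (- X^T) K) u = K u.
  have [[s ps0]|p0] := pselect (exists s, p s != 0).
    have [CF FC] := fmt_bounded iff; have [CG GC] := fmt_bounded ig.
    apply: (@fourier_inversion _ _ X K p (CF * CG * 2) (c0 * c0) _ _ _ _ _ _ _ s) => //.
    - move=> w; apply: (le_trans (norm1M _ _)).
      apply: ler_pM; rewrite ?norm1_ge0 ?norm1_expi//.
      by apply: (le_trans (norm1M _ _)); apply: ler_pM; rewrite ?norm1_ge0.
    - apply: ray_continuousM; last exact: ray_continuous_expi_quad.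
      by apply: ray_continuousM; exact: fmt_ray_continuous.
  have p00 : p = fun=> 0.
    apply/funext => t; apply/eqP/negPn/negP => pt0.
    by apply: p0; exists t.
  have fourier0 Y v : fourier Y (fun=> 0 : R[i]) v = 0.
    rewrite /fourier; under eq_fun do rewrite mul0r.
    by rewrite /cintegral /= !Rintegral_cst// !mul0r.
  have K0 : K = fun=> 0.
    by apply/funext => v; rewrite /K mulrAC FE /P p00 fourier0 mulr0 mul0r.
  have Z0 : fourier (- X^T) K = fun=> 0.
    by apply/funext => t; rewrite K0 fourier0.
  by rewrite Z0 fourier0 mulr0 K0.
rewrite fmt_fourier// (funext zE) fourierZ//.
have -> : c0 * (ch u * (c0 * fourier X (fourier (- X^T) K) u)) =
  ch u * (c0 * c0 * fourier X (fourier (- X^T) K) u) by ring.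
rewrite KE /K.
have -> : ch u * (F u * G u * ch' u) = ch u * ch' u * (F u * G u) by ring.
by rewrite chirp_uN mul1r.
Qed.

End convolution_theorem.

Theorem theorem1 (R : realType) (N : nat) (HN : (0 < N)%N)
    (M : 'M[R]_(N + N)) (HM : free_symplectic M)
    (f g : 'rV[R]_N -> R[i]) (Hf : is_signal M f) (Hg : is_signal M g) :
  (forall u0 : 'rV[R]_N,
     (cintegrable (fmconv M f g u0) ->
      forall u : 'rV[R]_N,
        fmt M (fmconv M f g u0) u = fmt M f u * fmt M g u) /\
     (forall t : 'rV[R]_N,
        fmconv M f g u0 t = ifmt M (fun u => fmt M f u * fmt M g u) t)) /\
  (forall t0 u : 'rV[R]_N,
     fmt M (fun t => f t * g t) u = fmconv_spec M f g t0 u).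
Proof.
have [_ _ _ detB0] := HM.
split=> [u0|t0 u]; last exact: fmt_product.
split=> [iz u|t]; last exact: fmconv_ifmt.
exact: fmt_fmconv.
Qed.
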